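(* For any tensor $\boldsymbol{\mathcal T}\in\mathbb{R}^{p_1\times\cdots\times p_d}$ and $1\le i<j\le d-1$, $$[\boldsymbol{\mathcal T}]_j=\bigl(I_{p_{i+1}\cdots p_j}\otimes[\boldsymbol{\mathcal T}]_i\bigr)A^{(p_{i+1}\cdots p_j,\;p_{j+1}\cdots p_d)},\qquad[\boldsymbol{\mathcal T}]_i=A^{(p_{i+1}\cdots p_j,\;p_1\cdots p_i)\top}\bigl([\boldsymbol{\mathcal T}]_j\otimes I_{p_{i+1}\cdots p_j}\bigr).$$
   Context: The sequential unfolding $[\boldsymbol{\mathcal T}]_k\in\mathbb{R}^{(p_1\cdots p_k)\times(p_{k+1}\cdots p_d)}$ has entry $\boldsymbol{\mathcal T}_{i_1,\dots,i_d}$ at row $i_1+(i_2-1)p_1+\cdots+(i_k-1)p_1\cdots p_{k-1}$ and column $i_{k+1}+(i_{k+2}-1)p_{k+1}+\cdots+(i_d-1)p_{k+1}\cdots p_{d-1}$. $U\otimes V$ is the usual Kronecker product, with blocks $U_{ij}V$. For positive integers $i,j$, let $e_k^{(ij)}$ be the $k$th canonical basis vector of $\mathbb{R}^{ij}$ and $$A^{(i,j)}=\begin{bmatrix} e_1^{(ij)} & e_{i+1}^{(ij)} & \cdots & e_{i(j-1)+1}^{(ij)} \\ e_2^{(ij)} & e_{i+2}^{(ij)} & \cdots & e_{i(j-1)+2}^{(ij)} \\ \vdots & \vdots & \ddots & \vdots \\ e_i^{(ij)} & e_{2i}^{(ij)} & \cdots & e_{ij}^{(ij)} \end{bmatrix}\in\mathbb{R}^{(i^2j)\times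 j},$$ i.e. the $a$th block row ($1\le a\le i$), of height $ij$, has $b$th column $e_{i(b-1)+a}^{(ij)}$, $1\le b\le j$. *)

(* Defs.v *)
From HB Require Import structures.
From mathcomp Require Import all_boot all_order all_algebra.
From mathcomp Require Import zify reals.
(* [mxtens] provides the Kronecker product [A *t B], with blocks A i j *: B. *)
From mathcomp Require Export mxtens.

Set Implicit Arguments.
Unset Strict Implicit.
Unset Printing Implicit Defensive.

Import GRing.Theory.
Local Open Scope ring_scope.

(* All indices are 0-based: modes are k : 'I_d, and the k-th index of an entry
   of a tensor ranges over 'I_(p k). *)

Definition multi_index (d : nat) (p : 'I_d -> nat) : finType :=
  {dffun forall k : 'I_d, 'I_(p k)}.

Definition tensor (R : Type) (d : nat) (p : 'I_d -> nat) : Type :=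
  {ffun multi_index p -> R}.

(* The 0-based modes a, ..., b - 1 are the 1-based modes a + 1, ..., b, so this
   is the product written p_(a+1) ... p_b with 1-based modes. *)
Definition dimprod (d : nat) (p : 'I_d -> nat) (a b : nat) : nat :=
  (\prod_(k < d | a <= k < b) p k)%N.

(* i_(a+1) + i_(a+2) p_(a+1) + ... + i_b p_(a+1) ... p_(b-1) with 1-based modes
   and 0-based entries. *)
Definition linear_index (d : nat) (p : 'I_d -> nat) (a b : nat)
    (x : multi_index p) : nat :=
  (\sum_(k < d | a <= k < b) x k * dimprod p a k)%N.

(* At most one multi-index x contributes to each sum; see [unfoldingE]. *)
Definition unfolding (R : pzRingType) (d : nat) (p : 'I_d -> nat)
    (T : tensor R p) (k : nat) : 'M[R]_(dimprod p 0 k, dimprod p k d) :=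
  \matrix_(r, c) \sum_(x : multi_index p | (linear_index 0 k x == r)
                                        && (linear_index k d x == c)) T x.

(* With 0-based indices, column b of block row a is the canonical basis vector
   of index i * b + a in dimension i * j. *)
Definition Amx (R : pzRingType) (i j : nat) : 'M[R]_(i ^ 2 * j, j) :=
  \matrix_(r, b) (r %% (i * j) == i * b + r %/ (i * j))%N%:R.

Section Facts.

Variables (d : nat) (p : 'I_d -> nat).

Lemma mode_range_cat (a b c : nat) (k : 'I_d) : (a <= b <= c)%N ->
  ((a <= k < c) && (k < b) = (a <= k < b))%N
  * ((a <= k < c) && ~~ (k < b) = (b <= k < c))%N.
Proof. by move=> /andP[ab bc]; split; apply/idP/idP; lia. Qed.

Lemma dimprod_cat (a b c : nat) : (a <= b <= c)%N ->
  (dimprod p a b * dimprod p b c = dimprod p a c)%N.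
Proof.
move=> abc; rewrite /dimprod [RHS](bigID (fun k : 'I_d => k < b)%N) /=.
by congr (_ * _)%N; apply: eq_bigl => k; rewrite (mode_range_cat k abc).
Qed.

(* Dimension identities behind the casts in the matrix products. *)

Lemma dimprod_catC (a b c : nat) : (a <= b)%N -> (b <= c)%N ->
  (dimprod p b c * dimprod p a b = dimprod p a c)%N.
Proof. by move=> ab bc; rewrite mulnC dimprod_cat // ab. Qed.

Lemma Amx_rowsl (a b c : nat) : (a <= b)%N -> (b <= c)%N ->
  (dimprod p a b ^ 2 * dimprod p b c = dimprod p a b * dimprod p a c)%N.
Proof. by move=> ab bc; rewrite -mulnn -mulnA dimprod_cat // ab. Qed.

Lemma Amx_rowsr (a b c : nat) : (a <= b)%N -> (b <= c)%N ->
  (dimprod p b c ^ 2 * dimprod p a b = dimprod p a c * dimprod p b c)%N.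
Proof. by move=> ab bc; rewrite -mulnn -mulnA dimprod_catC // mulnC. Qed.

Lemma linear_index_cat (a b c : nat) (x : multi_index p) : (a <= b <= c)%N ->
  (linear_index a c x
   = linear_index a b x + dimprod p a b * linear_index b c x)%N.
Proof.
move=> abc; rewrite /linear_index (bigID (fun k : 'I_d => k < b)%N) /=.
congr (_ + _)%N; first by apply: eq_bigl => k; rewrite (mode_range_cat k abc).
rewrite big_distrr; apply: eq_big => k; rewrite (mode_range_cat k abc) //.
move=> /andP[bk _]; rewrite -(@dimprod_cat a b k) ?bk ?andbT 1?mulnCA //.
by case/andP: abc.
Qed.

Lemma mode_range1 (k l : 'I_d) : (k <= l < k.+1)%N = (l == k).
Proof. by rewrite ltnS -eqn_leq eq_sym. Qed.

Lemma dimprod1 (k : 'I_d) : dimprod p k k.+1 = p k.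
Proof. by rewrite /dimprod (eq_bigl _ _ (mode_range1 k)) big_pred1_eq. Qed.

Lemma dimprod0 (a : nat) : dimprod p a a = 1%N.
Proof. by rewrite /dimprod big_pred0 // => k; lia. Qed.

Lemma linear_index1 (k : 'I_d) (x : multi_index p) :
  linear_index k k.+1 x = x k.
Proof.
by rewrite /linear_index (eq_bigl _ _ (mode_range1 k)) big_pred1_eq dimprod0 muln1.
Qed.

Lemma ltn_linear_index (a b : nat) (x : multi_index p) :
  (linear_index a b x < dimprod p a b)%N.
Proof.
have [ba|] := leqP b a.
  by rewrite /linear_index /dimprod !big_pred0 // => k; lia.
elim: b => // b IHb; rewrite ltnS => ab.
have [bd|db] := ltnP b d; last first.
  have E (k : 'I_d) : (a <= k < b.+1 = (a <= k < b))%N.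
    by have := ltn_ord k; lia.
  rewrite /linear_index /dimprod !(eq_bigl _ _ E).
  move: ab; rewrite leq_eqVlt => /predU1P[->|/IHb//].
  by rewrite !big_pred0 // => k; lia.
have abb : (a <= b <= b.+1)%N by rewrite ab leqnSn.
rewrite (linear_index_cat x abb) -(dimprod_cat abb).
have -> : b = Ordinal bd by [].
rewrite linear_index1 dimprod1.
have {}IHb : (linear_index a b x < dimprod p a b)%N.
  move: ab; rewrite leq_eqVlt => /predU1P[->|/IHb//].
  by rewrite dimprod0 /linear_index big_pred0 // => k; lia.
apply: (@leq_trans (dimprod p a b * (x (Ordinal bd)).+1)%N).
  by rewrite mulnS ltn_add2r.
by rewrite leq_mul2l ltn_ord orbT.
Qed.

Lemma linear_index_inj (a b : nat) (x y : multi_index p) :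
  linear_index a b x = linear_index a b y ->
  forall k : 'I_d, (a <= k < b)%N -> x k = y k.
Proof.
move=> exy k /andP[ak kb]; apply: val_inj => /=.
have split2 (u v : nat) (z t : multi_index p) (w : nat) : (u <= v <= w)%N ->
    linear_index u w z = linear_index u w t ->
    linear_index u v z = linear_index u v t
    /\ linear_index v w z = linear_index v w t.
  move=> uvw; rewrite !(linear_index_cat _ uvw).
  have := ltn_linear_index u v z; have := ltn_linear_index u v t.
  move: (dimprod p u v) => q ltt ltz e.
  have q_gt0 : (0 < q)%N by case: q ltt {ltz e}.
  have e1 : linear_index u v z = linear_index u v t.
    have := congr1 (modn^~ q) e.
    by rewrite ![(_ + q * _)%N]addnC ![(q * _)%N]mulnC !modnMDl !modn_small.
  split=> //; move: e; rewrite e1 => /addnI /eqP.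
  by rewrite eqn_pmul2l // => /eqP.
have akb : (a <= k <= b)%N by rewrite ak ltnW.
have kkb : (k <= k.+1 <= b)%N by rewrite leqnSn.
have [_ /(split2 _ _ _ _ _ kkb)[]] := split2 _ _ _ _ _ akb exy.
by rewrite !linear_index1.
Qed.

Lemma unfoldingE (R : pzRingType) (T : tensor R p) (k : nat)
    (x : multi_index p) :
  unfolding T k (Ordinal (ltn_linear_index 0 k x))
                (Ordinal (ltn_linear_index k d x)) = T x.
Proof.
rewrite mxE (big_pred1 x) // => y /=; apply/andP/eqP => [[/eqP e1 /eqP e2]|->//].
apply/ffunP => l; have [lk|kl] := ltnP l k.
  by apply: (linear_index_inj e1).
by apply: (linear_index_inj e2); rewrite kl ltn_ord.
Qed.

End Facts.

(* Main.v *)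
Require Import Defs.
From mathcomp Require Import all_boot all_order all_algebra.
From mathcomp Require Import zify reals.
Import GRing.Theory.
Local Open Scope ring_scope.

(** Unfoldings of the same tensor differ only in how its entries are grouped.
    Listing the entries in colexicographic order gives one sequence g, and the
    k-th unfolding is g cut into consecutive columns of height p_1 ... p_k
    ([unfolding_colmajor]).  The theorem is thus a statement about an arbitrary
    sequence g, with m = p_1 ... p_i, q = p_(i+1) ... p_j, n = p_(j+1) ... p_d:
    it compares the m x qn matrix B and the qm x n matrix C that both read g
    column by column.  Column l of C is the stack of the q columns
    q l, ..., q l + q - 1 of B.

    Column l of A^(q,n) has exactly one 1 in each of its q block rows, at
    position q l + b in block row b, so a product with A^(q,n) is a sum over
    the block rows b < q ([sum_mul_Amx]).  In both identities the identity
    matrix of the Kronecker product then keeps a single value of b.  The row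
    where block row b has its 1 factors in two ways,

      b (q n) + (l q + b) = (b n + l) q + b.

    The left side is an index of the columns of I_q (x) B: it selects block b
    and, inside it, column l q + b of B ([colmajor_stack]).  The right side,
    with n and l replaced by m and a row r of B, is an index of the rows of
    C (x) I_q: it selects row b m + r of C and coordinate b of I_q
    ([colmajor_unstack]). *)

Definition colmajor {R : Type} (g : nat -> R) (m n : nat) : 'M[R]_(m, n) :=
  \matrix_(r, c) g (r + m * c)%N.

(** In column [l], block row [b] of [A^(q,n)] has height [q * n] and its only 1
    at offset [q * l + b < q * n]; Euclidean division by [q * n] therefore
    recovers [b] from the position [pos b].  The cast [eA] is there because the
    other factor of the products below writes the dimension [q ^ 2 * n]
    in two different ways, as [q * (q n)] and as [(q n) * q]. *)
Lemma sum_mul_Amx {R : pzRingType} {q n K : nat} (eA : (q ^ 2 * n = K)%N)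
    (F : 'I_K -> R) (l : 'I_n) (pos : 'I_q -> 'I_K)
    (posE : forall b : 'I_q, pos b = (b * (q * n) + (q * l + b))%N :> nat) :
  \sum_k F k * castmx (eA, erefl n) (Amx R q n) k l = \sum_b F (pos b).
Proof.
subst K.
under eq_bigr => k _ do rewrite castmx_id mxE mulr_natr mulrb.
rewrite -big_mkcond /=.
have n_gt0 : (0 < n)%N := leq_ltn_trans (leq0n l) (ltn_ord l).
have block_lt (k : 'I_(q ^ 2 * n)) : (k %/ (q * n) < q)%N.
  have q_gt0 : (0 < q)%N by case: q k {F pos posE} => //; case.
  by rewrite ltn_divLR ?muln_gt0 ?q_gt0 // mulnA mulnn.
have off_lt (b : 'I_q) : (q * l + b < q * n)%N.
  apply: (@leq_trans (q * l.+1)); first by rewrite mulnS addnC ltn_add2r.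
  by rewrite leq_mul2l ltn_ord orbT.
have posM b : (pos b %% (q * n) = q * l + b)%N.
  by rewrite posE modnMDl modn_small.
have posD b : (pos b %/ (q * n) = b)%N.
  have qn_gt0 : (0 < q * n)%N := leq_ltn_trans (leq0n _) (off_lt b).
  by rewrite posE divnMDl // divn_small ?addn0.
rewrite (reindex_onto pos (fun k => Ordinal (block_lt k))) /=.
  apply: eq_bigl => b; have -> : Ordinal (block_lt (pos b)) = b.
    exact/val_inj/posD.
  by rewrite posM posD !eqxx.
move=> k /eqP kM; apply/ord_inj; rewrite posE /= -kM.
exact/esym/divn_eq.
Qed.

Lemma sum_mul_id {R : pzRingType} {q : nat} (a : 'I_q) (G : 'I_q -> R) :
  \sum_b (1%:M : 'M[R]_q) a b * G b = G a.
Proof.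
under eq_bigr => b _ do rewrite mxE eq_sym mulr_natl mulrb.
by rewrite -big_mkcond /= big_pred1_eq.
Qed.

(** Multiplying by [1%:M *t B] on the left makes row [a m + s] see only block
    [a]; there [A^(q,n)] selects column [q l + a] of [B], and both sides read
    [g] at [a m + s + q m l = s + m (q l + a)]. *)
Lemma colmajor_stack {R : pzRingType} (g : nat -> R) {m q n M N : nat}
    (eM : (q * m = M)%N) (eA : (q ^ 2 * n = q * N)%N) (eN : (q * n = N)%N) :
  colmajor g M n
  = castmx (eM, erefl n)
      (((1%:M : 'M[R]_q) *t colmajor g m N) *m
       castmx (eA, erefl n) (Amx R q n)).
Proof.
subst M; apply/matrixP => r l; rewrite castmx_id.
case: r / (mxtens_indexP r) => a s; rewrite [RHS]mxE.
have eC : (n * q = N)%N by rewrite mulnC.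
rewrite (sum_mul_Amx eA _ _
  (fun b => mxtens_index (b, cast_ord eC (mxtens_index (l, b))))).
  under eq_bigr => b _ do rewrite tensmxE.
  rewrite (sum_mul_id a (fun b => colmajor g m N s _)) !mxE /=.
  by congr (g _); lia.
by move=> b /=; rewrite eN [(l * q)%N]mulnC.
Qed.

(** The same identity [r + m (q l + a) = (a m + r) + q m l], read the other
    way: block row [b] of [A^(q,m)] picks row [b m + r] of the tall matrix, and
    coordinate [b] of the identity factor keeps only [b = a]. *)
Lemma colmajor_unstack {R : comPzRingType} (g : nat -> R) {m q n M N : nat}
    (eM : (q * m = M)%N) (eA : (q ^ 2 * m = M * q)%N) (eN : (n * q = N)%N) :
  colmajor g m N
  = castmx (erefl m, eN)
      ((castmx (eA, erefl m) (Amx R q m))^T *m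
       (colmajor g M n *t (1%:M : 'M[R]_q))).
Proof.
subst N; apply/matrixP => r c; rewrite castmx_id.
case: c / (mxtens_indexP c) => l a; rewrite [RHS]mxE.
under [RHS]eq_bigr => k _ do rewrite mxE mulrC.
rewrite (sum_mul_Amx eA _ _
  (fun b => mxtens_index (cast_ord eM (mxtens_index (b, r)), b))).
  (* The identity factor carries the summation index in its row. *)
  under eq_bigr => b _ do rewrite tensmxE mulrC -[1%:M]trmx1 mxE.
  rewrite (sum_mul_id a (fun b => colmajor g M n _ l)) !mxE /=.
  by congr (g _); rewrite -eM; lia.
by move=> b /=; lia.
Qed.

(** The linear index over all modes is [u + P v], with [P] the product of the
    first [k] dimensions, [u < P] the linear index over the first [k] modes and
    [v] the one over the others.  By uniqueness of Euclidean division it equals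
    [r + P c] exactly when [u = r] and [v = c], so the sequence does not depend
    on [k]. *)
Lemma unfolding_colmajor {R : pzRingType} {d : nat} {p : 'I_d -> nat}
    (T : tensor R p) (k : nat) : (k <= d)%N ->
  unfolding T k
  = colmajor (fun N => \sum_(x | linear_index 0 d x == N) T x) _ _.
Proof.
move=> kd; apply/matrixP => r c; rewrite !mxE; apply: eq_bigl => x.
rewrite (@linear_index_cat _ _ 0 k d x) ?leq0n //.
have xr := ltn_linear_index 0 k x; have rlt := ltn_ord r.
apply/andP/eqP => [[/eqP-> /eqP->] // | e].
have e0 : linear_index 0 k x = r.
  have := congr1 (modn^~ (dimprod p 0 k)) e.
  by rewrite ![(_ + _ * _)%N]addnC ![(dimprod p 0 k * _)%N]mulnC
    !modnMDl !modn_small.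
by move/eqP: e; rewrite e0 eqn_add2l eqn_pmul2l ?(leq_ltn_trans _ rlt) //.
Qed.

Theorem lemma3p2 (R : realType) (d : nat) (p : 'I_d -> nat)
    (hp : forall k : 'I_d, (0 < p k)%N) (T : tensor R p) (i j : nat)
    (hi : (1 <= i)%N) (hij : (i < j)%N) (hj : (j <= d.-1)%N) :
  unfolding T j
  = castmx (dimprod_catC p (leq0n i) (ltnW hij), erefl _)
      (((1%:M : 'M[R]_(dimprod p i j)) *t unfolding T i) *m
       castmx (Amx_rowsl p (ltnW hij) (leq_trans hj (leq_pred d)), erefl _)
         (Amx R (dimprod p i j) (dimprod p j d)))
  /\
  unfolding T i
  = castmx (erefl _, dimprod_catC p (ltnW hij) (leq_trans hj (leq_pred d)))
      ((castmx (Amx_rowsr p (leq0n i) (ltnW hij), erefl _)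
          (Amx R (dimprod p i j) (dimprod p 0 i)))^T *m
       (unfolding T j *t (1%:M : 'M[R]_(dimprod p i j)))).
Proof.
have jd := leq_trans hj (leq_pred d); have id := leq_trans (ltnW hij) jd.
rewrite (unfolding_colmajor T i id) (unfolding_colmajor T j jd); split.
  apply: colmajor_stack.
  by apply: dimprod_cat; rewrite (ltnW hij) jd.
apply: colmajor_unstack.
by apply: dimprod_catC (leq0n i) (ltnW hij).
Qed.
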